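(* Let $p$ be a prime, let $d$ be an integer, and let $A$ be a commutative algebra over a field $K$ of characteristic $p>0$ with $\mathrm{Card}(K)>d>1$. If $T$ is a strict homogeneous polynomial functor of degree $d$ over $A$, then $$\mathsf{HML}_\bullet(A,T)=0=\mathsf{HML}^\bullet(A,T).$$
   Context: For an associative ring $R$, $\mathbf{F}(R)$ is the category of finitely generated free left $R$-modules, and $\mathscr{F}(R)$ is the abelian category of all covariant functors from $\mathbf{F}(R)$ to the category of all left $R$-modules. Let $I\in\mathscr{F}(R)$ be the inclusion functor. MacLane cohomology of $R$ with coefficients in $T\in\mathscr{F}(R)$ is $\mathsf{HML}^\bullet(R,T)=\mathrm{Ext}^\bullet_{\mathscr{F}(R)}(I,T)$. MacLane homology is defined dually: $\mathsf{HML}_\bullet(R,T)=\mathrm{Tor}_\bullet^{\mathscr{F}(R)}(I^*,T)$, where $I^*(X)=\mathrm{Hom}_R(X,R)$ is the contravariant functor from $\mathbf{F}(R)$ to right $R$-modules and $\mathrm{Tor}_\bullet^{\mathscr{F}(R)}(I^*,-)$ denotes the left derived functors of the functor sending $T$ to the coend $\int^{X\in\mathbf{F}(R)} I^*(X)\otimes_R T(X)$. For a commutative ring $A$, $\mathscr{P}_d(A)$ denotes the abelian category of strict homogeneous polynomial functors of degree $d$ over $A$ (in the sense of Friedlander and Suslin): these are the $A$-linear functors to $A$-modules from the category whose objects are the finitely generated free $A$-modules and whose morphisms from $X$ to $Y$ are $\Gamma^d(\mathrm{Hom}_A(X,Y))$, where $\Gamma^d(M)=(M^{\otimes_A d})^{\Sigma_d}$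 (composition being induced by composition of linear maps). There is an exact functor $i:\mathscr{P}_d(A)\to\mathscr{F}(A)$, which keeps the values on objects and lets a linear map $f:X\to Y$ act through $f^{\otimes d}\in\Gamma^d(\mathrm{Hom}_A(X,Y))$. For $T\in\mathscr{P}_d(A)$ one writes $\mathsf{HML}_\bullet(A,T)$ and $\mathsf{HML}^\bullet(A,T)$ for $\mathsf{HML}_\bullet(A,i(T))$ and $\mathsf{HML}^\bullet(A,i(T))$. *)

(* Defs.v *)
From HB Require Import structures.
From mathcomp Require Import all_boot all_order all_algebra perm.
From mathcomp Require Import boolp.
From mathcomp.multinomials Require Import freeg.

Set Implicit Arguments.
Unset Strict Implicit.
Unset Printing Implicit Defensive.

Import GRing.Theory VectorInternalTheory.
Local Open Scope ring_scope.

Local Obligation Tactic := idtac.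

(* The category F(R) of finitely generated free left R-modules is taken in    *)
(* its skeletal form, so that it is small: its objects are the left R-modules *)
(* R^n = 'rV[R]_n, n : nat, and its morphisms from R^m to R^n are all the     *)
(* R-linear maps.                                                             *)
Notation flin R m n := 'Hom('rV[R]_m, 'rV[R]_n).

Record functor (R : nzRingType) := Functor {
  fob :> nat -> lmodType R;
  fmap : forall m n, flin R m n -> fob m -> fob n;
  fmap_linear : forall m n (f : flin R m n), linear (fmap f);
  fmap1 : forall n (x : fob n), fmap \1%VF x = x;
  fmapM : forall l m n (g : flin R m n) (f : flin R l m) (x : fob l),
    fmap (g \o f)%VF x = fmap g (fmap f x) }.
Arguments fmap {R} F {m n} f x : rename.

HB.instance Definition _ (R : nzRingType) (F : functor R) m n
    (f : flin R m n) :=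
  GRing.isLinear.Build R (F m) (F n) _ (fmap F f) (fmap_linear f).

Record nattrans (R : nzRingType) (F G : functor R) := NatTrans {
  ntfun :> forall n, F n -> G n;
  nt_linear : forall n, linear (@ntfun n);
  nt_natural : forall m n (f : flin R m n) (x : F m),
    ntfun (fmap F f x) = fmap G f (ntfun x) }.

HB.instance Definition _ (R : nzRingType) (F G : functor R)
    (a : nattrans F G) n :=
  GRing.isLinear.Build R (F n) (G n) _ (a n) (nt_linear (n := n) a).

Section NatTransZmod.
Variables (R : nzRingType) (F G : functor R).

Lemma nattransP (a b : nattrans F G) : (forall n x, a n x = b n x) -> a = b.
Proof.
case: a b => [a la na] [b lb nb] /= ab.
have E : a = b by apply: functional_extensionality_dep => n; apply/funext => x.
by rewrite E in la na *; congr NatTrans; apply: Prop_irrelevance.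
Qed.

HB.instance Definition _ := gen_eqMixin (nattrans F G).
HB.instance Definition _ := gen_choiceMixin (nattrans F G).

Program Definition nt_zero : nattrans F G := @NatTrans R F G (fun n _ => 0) _ _.
Next Obligation. by move=> n a x y; rewrite scaler0 addr0. Qed.
Next Obligation. by move=> m n f x; rewrite linear0. Qed.

Program Definition nt_add (a b : nattrans F G) : nattrans F G :=
  @NatTrans R F G (fun n x => a n x + b n x) _ _.
Next Obligation. by move=> a b n k x y; rewrite !linearP scalerDr addrACA. Qed.
Next Obligation. by move=> a b m n f x; rewrite /= !nt_natural linearD. Qed.

Program Definition nt_opp (a : nattrans F G) : nattrans F G :=
  @NatTrans R F G (fun n x => - a n x) _ _.
Next Obligation. by move=> a n k x y; rewrite linearP opprD scalerN. Qed.
Next Obligation. by move=> a m n f x; rewrite /= nt_natural linearN. Qed.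

Fact nt_addA : associative nt_add.
Proof. by move=> a b c; apply: nattransP => n x /=; rewrite addrA. Qed.
Fact nt_addC : commutative nt_add.
Proof. by move=> a b; apply: nattransP => n x /=; rewrite addrC. Qed.
Fact nt_add0 : left_id nt_zero nt_add.
Proof. by move=> a; apply: nattransP => n x /=; rewrite add0r. Qed.
Fact nt_addN : left_inverse nt_zero nt_opp nt_add.
Proof. by move=> a; apply: nattransP => n x /=; rewrite addNr. Qed.

HB.instance Definition _ := GRing.isZmodule.Build (nattrans F G)
  nt_addA nt_addC nt_add0 nt_addN.

End NatTransZmod.

Program Definition nt_comp (R : nzRingType) (F G H : functor R)
    (b : nattrans G H) (a : nattrans F G) : nattrans F H :=
  @NatTrans R F H (fun n x => b n (a n x)) _ _.
Next Obligation. by move=> R F G H b a n k x y; rewrite !linearP. Qed.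
Next Obligation. by move=> R F G H b a m n f x; rewrite /= !nt_natural. Qed.

Section Homology.
Variables (U V W : zmodType) (f : {additive U -> V}) (g : {additive V -> W}).

Definition cycles : {pred V} := [pred x | g x == 0].
Fact cycles_zmod_closed : zmod_closed cycles.
Proof.
split=> [|x y]; rewrite !inE ?raddf0 // => /eqP gx /eqP gy.
by rewrite raddfB gx gy subrr.
Qed.
HB.instance Definition _ := GRing.isZmodClosed.Build V cycles cycles_zmod_closed.

Record cycle := Cycle { cycle_val : V; _ : cycle_val \in cycles }.
HB.instance Definition _ := [isSub for cycle_val].
HB.instance Definition _ := [Choice of cycle by <:].
HB.instance Definition _ := [SubChoice_isSubZmodule of cycle by <:].

Definition boundaries : {pred cycle} :=
  [pred z | `[< exists u, f u = cycle_val z >]].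
Fact boundaries_zmod_closed : zmod_closed boundaries.
Proof.
split=> [|x y]; rewrite !inE; first by apply/asboolP; exists 0; rewrite !raddf0.
move=> /asboolP[u fu] /asboolP[v fv]; apply/asboolP; exists (u - v).
by rewrite raddfB fu fv.
Qed.
HB.instance Definition _ :=
  GRing.isZmodClosed.Build cycle boundaries boundaries_zmod_closed.

(* ker g / im f *)
Definition homology : zmodType := Quotient.quot boundaries.

End Homology.

Section QuotLift.
Local Open Scope quotient_scope.
Variables (V W : zmodType) (I : zmodClosed V) (h : {additive V -> W}).
Hypothesis hI : forall x, x \in I -> h x = 0.

Definition quot_lift (x : Quotient.quot I) : W := h (repr x).

Lemma quot_liftE x : quot_lift (\pi x) = h x.
Proof.
apply/eqP; rewrite -subr_eq0 -raddfB; apply/eqP/hI.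
by rewrite Quotient.idealrBE reprK.
Qed.

Fact quot_lift_additive : additive quot_lift.
Proof.
move=> x y; rewrite -[x]reprK -[y]reprK -[_ - _](raddfB (\pi_(Quotient.quot I))).
by rewrite !quot_liftE raddfB.
Qed.
HB.instance Definition _ :=
  GRing.isAdditive.Build (Quotient.quot I) W quot_lift quot_lift_additive.

End QuotLift.

Definition projective (R : nzRingType) (P : functor R) : Prop :=
  forall (F G : functor R) (q : nattrans F G) (a : nattrans P G),
    (forall n (y : G n), exists x, q n x = y) -> exists b, nt_comp q b = a.

Record resolution (R : nzRingType) (T : functor R) := Resolution {
  res :> nat -> functor R;
  res_diff : forall i, nattrans (res i.+1) (res i);
  res_aug : nattrans (res 0%N) T;
  res_proj : forall i, projective (res i);
  res_aug_surj : forall n (t : T n), exists x, res_aug n x = t;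
  res_exact0 : forall n (x : res 0%N n),
    res_aug n x = 0 <-> exists y, res_diff 0%N n y = x;
  res_exact : forall i n (x : res i.+1 n),
    res_diff i n x = 0 <-> exists y, res_diff i.+1 n y = x }.

Section FreegLift.
Variables (R : nzRingType) (K : choiceType) (M : lmodType R).

Lemma fglift_linear (f : K -> M) : linear (fglift f).
Proof.
have addf : additive (fglift f) := lift_is_additive f.
pose fa : {additive {freeg K / R} -> M} :=
  HB.pack (fglift f) (GRing.isAdditive.Build _ _ _ addf).
have sc c D : fa (c *: D) = c *: fa D.
  rewrite -{2}[D]freeg_sumE [c *: D]/(fgscale c D) /fgscale !raddf_sum.
  by apply: eq_bigr => x _; rewrite /= !liftU scalerA.
by move=> c x y; rewrite -[fglift f]/(fa : _ -> _) raddfD sc.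
Qed.
HB.instance Definition _ (f : K -> M) :=
  GRing.isLinear.Build R {freeg K / R} M _ (fglift f) (fglift_linear f).

Lemma freeg_eqP (f g : {freeg K / R} -> M) : linear f -> linear g ->
  (forall k, f << k >> = g << k >>) -> f =1 g.
Proof.
move=> lf lg fg D.
have h0 h : linear h -> h (0 : {freeg K / R}) = 0 :> M.
  by move=> lh; have := lh (-1) 0 0; rewrite !scaleN1r !addNr.
rewrite -[D]freeg_sumE; elim: (dom D) => [|k s IHs].
  by rewrite !big_nil (h0 f lf) (h0 g lg).
rewrite !big_cons.
have -> : << coeff k D *g k >> = coeff k D *: << k >> :> {freeg K / R}.
  by apply/eqP/freeg.freeg_eqP => x; rewrite coeffZ !coeffU mul1r.
by rewrite lf lg fg IHs.
Qed.

End FreegLift.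

(* The direct sum over j : J of the projectives R[Hom(R^(deg j), -)].         *)
Section FreeFunctor.
Variables (R : nzRingType) (J : Type) (deg : J -> nat).

Definition free_gen n : choiceType := {classic {j : J & flin R (deg j) n}}.
Definition free_genE n j (f : flin R (deg j) n) : free_gen n := existT _ j f.
Definition free_ob n : lmodType R := {freeg (free_gen n) / R}.
Definition free_map m n (g : flin R m n) : free_ob m -> free_ob n :=
  fglift (fun jf : free_gen m => << free_genE (g \o projT2 jf)%VF >>).

Fact free_map_linear m n (g : flin R m n) : linear (free_map g).
Proof. exact: linearP. Qed.
HB.instance Definition _ m n (g : flin R m n) :=
  GRing.isLinear.Build R (free_ob m) (free_ob n) _ (free_map g)
    (free_map_linear g).

Lemma free_mapE m n (g : flin R m n) j f :
  free_map g << @free_genE m j f >> = << free_genE (g \o f)%VF >>.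
Proof. by rewrite /free_map liftU scale1r. Qed.

Program Definition free_functor : functor R :=
  @Functor R free_ob free_map free_map_linear _ _.
Next Obligation.
move=> n; apply: freeg_eqP => [||[j f]]; [exact: linearP | by [] |].
by rewrite -/(free_genE f) free_mapE comp_lfun1l.
Qed.
Next Obligation.
move=> l m n g f; apply: freeg_eqP => [||[j h]]; first exact: linearP.
  by move=> c x y; rewrite !linearP.
by rewrite -/(free_genE h) !free_mapE comp_lfunA.
Qed.

Variables (F : functor R) (u : forall j, F (deg j)).

Definition free_lift_fun n : free_functor n -> F n :=
  fglift (fun jf : free_gen n => fmap F (projT2 jf) (u (projT1 jf))).

Fact free_lift_linear n : linear (@free_lift_fun n).
Proof. exact: fglift_linear. Qed.

Lemma free_lift_funE n j (f : flin R (deg j) n) :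
  free_lift_fun << free_genE f >> = fmap F f (u j).
Proof. by rewrite /free_lift_fun liftU scale1r. Qed.

Program Definition free_lift : nattrans free_functor F :=
  @NatTrans R free_functor F free_lift_fun free_lift_linear _.
Next Obligation.
move=> m n f; apply: freeg_eqP => [c x y|c x y|[j h]].
- by rewrite linearP free_lift_linear.
- by rewrite free_lift_linear linearP.
by rewrite /= -/(free_genE h) free_mapE !free_lift_funE fmapM.
Qed.

End FreeFunctor.

Lemma free_functor_projective (R : nzRingType) (J : Type) (deg : J -> nat) :
  projective (free_functor R deg).
Proof.
move=> F G q a surj_q.
pose e j : free_functor R deg (deg j) := << @free_genE _ _ deg _ j \1%VF >>.
pose u j := cid (surj_q _ (a (deg j) (e j))).
exists (free_lift (fun j => sval (u j))); apply: nattransP => n.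
apply: freeg_eqP => [||[j f]].
- by move=> c x y; rewrite !nt_linear.
- by move=> c x y; rewrite nt_linear.
rewrite -/(free_genE f) /= free_lift_funE nt_natural (svalP (u j)) -nt_natural /=.
by rewrite free_mapE comp_lfun1r.
Qed.

Section StdResolution.
Variables (R : nzRingType).

Record stage := Stage {
  st_src : functor R; st_tgt : functor R; st_map : nattrans st_src st_tgt }.

(* The direct sum of the R[Hom(R^n, -)] over all n and all t in T(R^n).       *)
Definition first_stage (T : functor R) : stage :=
  Stage (free_lift (deg := fun j : {n : nat & T n} => projT1 j) (@projT2 _ _)).

(* The same sum, over all elements of the kernel of the previous map.         *)
Definition next_stage (s : stage) : stage :=
  Stage (free_lift
    (deg := fun j : {n : nat & {x : st_src s n | st_map s n x = 0}} => projT1 j)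
    (fun j => sval (projT2 j))).

Variable T : functor R.
Let stages i := iter i next_stage (first_stage T).

Lemma next_stage_exact s n (x : st_src s n) :
  st_map s n x = 0 <-> exists y, st_map (next_stage s) n y = x.
Proof.
split=> [x0|[y <-] {x}].
  exists << @free_genE _ _ _ _ (existT _ n (exist _ x x0)) \1%VF >>.
  by rewrite /= free_lift_funE fmap1.
move: y; apply: (freeg_eqP (g := fun=> 0)) => [c x y|c x y|[j f]].
- by rewrite !nt_linear.
- by rewrite scaler0 addr0.
rewrite -/(free_genE f) [X in st_map s n X]free_lift_funE nt_natural.
by case: (projT2 j) => x /= ->; rewrite linear0.
Qed.

Program Definition std_resolution : resolution T :=
  @Resolution R T (fun i => st_src (stages i)) (fun i => st_map (stages i.+1))
    (st_map (stages 0)) _ _ _ _.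
Next Obligation. by case=> [|i]; apply: free_functor_projective. Qed.
Next Obligation.
move=> n t; exists << @free_genE _ _ _ _ (existT _ n t) \1%VF >>.
by rewrite /= free_lift_funE fmap1.
Qed.
Next Obligation. move=> n x; exact (@next_stage_exact (stages 0%N) n x). Qed.
Next Obligation. move=> i n x; exact (@next_stage_exact (stages i.+1) n x). Qed.

End StdResolution.

Section Ext.
Variables (R : nzRingType) (G : functor R).

Definition precomp (P Q : functor R) (d : nattrans P Q) (a : nattrans Q G) :
  nattrans P G := nt_comp a d.
Fact precomp_additive P Q (d : nattrans P Q) : additive (precomp d).
Proof. by move=> a b; apply: nattransP. Qed.
HB.instance Definition _ P Q (d : nattrans P Q) :=
  GRing.isAdditive.Build (nattrans Q G) (nattrans P G) (precomp d)
    (precomp_additive d).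

Definition Ext_with (F : functor R) (P : resolution F) (i : nat) : zmodType :=
  if i is j.+1 then homology (precomp (res_diff P j)) (precomp (res_diff P j.+1))
  else homology (\0 : {additive nattrans (P 0%N) G -> nattrans (P 0%N) G})
                (precomp (res_diff P 0%N)).

End Ext.

Definition Ext (R : nzRingType) (F G : functor R) (i : nat) : zmodType :=
  Ext_with G (std_resolution F) i.

(* The coend of Hom_R(X, R) (x)_R T(X) over X in F(R): the abelian group      *)
(* generated by symbols phi (x) t, for phi in Hom_R(R^n, R) and t in T(R^n).  *)
(* Hom_R(R^n, R) is a right R-module for (phi r)(x) = phi(x) r.               *)
Section Coend.
Variables (R : nzRingType).

Notation flin_dual n := 'Hom('rV[R]_n, R^o).

Section CoendOb.
Variable T : functor R.

Definition cotensor : choiceType := {classic {n : nat & flin_dual n * T n}%type}.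
Definition cosym n (phi : flin_dual n) (t : T n) : {freeg cotensor / int} :=
  << (existT _ n (phi, t) : cotensor) >>.

Inductive coend_rel : {freeg cotensor / int} -> Prop :=
| CoendRel0 : coend_rel 0
| CoendRelB D E : coend_rel D -> coend_rel E -> coend_rel (D - E)
| CoendRelDl n (phi psi : flin_dual n) t :
    coend_rel (cosym (phi + psi) t - cosym phi t - cosym psi t)
| CoendRelDr n (phi : flin_dual n) t u :
    coend_rel (cosym phi (t + u) - cosym phi t - cosym phi u)
| CoendRelZ n r (phi psi : flin_dual n) t :
    (forall x, psi x = phi x * r) ->
    coend_rel (cosym psi t - cosym phi (r *: t))
| CoendRelF m n (f : flin R m n) (phi : flin_dual n) (t : T m) :
    coend_rel (cosym (phi \o f)%VF t - cosym phi (fmap T f t)).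

Definition coend_null : {pred {freeg cotensor / int}} :=
  [pred D | `[< coend_rel D >]].
Fact coend_null_zmod_closed : zmod_closed coend_null.
Proof.
split=> [|D E]; rewrite !inE; first exact/asboolP/CoendRel0.
by move=> /asboolP rD /asboolP rE; apply/asboolP/CoendRelB.
Qed.
HB.instance Definition _ := GRing.isZmodClosed.Build {freeg cotensor / int}
  coend_null coend_null_zmod_closed.

Definition coend : zmodType := Quotient.quot coend_null.

End CoendOb.

Section CoendMap.
Variables (F G : functor R) (a : nattrans F G).

Definition cotensor_map : {freeg (cotensor F) / int} -> coend G :=
  (\pi_(coend G))%qT \o fglift (fun s : cotensor F =>
    cosym (projT2 s).1 (a _ (projT2 s).2)).
Fact cotensor_map_additive : additive cotensor_map.
Proof. by move=> D E; rewrite /cotensor_map /= !raddfB. Qed.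
HB.instance Definition _ := GRing.isAdditive.Build
  {freeg (cotensor F) / int} (coend G) cotensor_map cotensor_map_additive.

Lemma cotensor_map_sym n (phi : flin_dual n) t :
  cotensor_map (cosym phi t) = (\pi_(coend G))%qT (cosym phi (a n t)).
Proof. by rewrite /cotensor_map /= liftU scale1r. Qed.

Lemma cotensor_map_null D : D \in @coend_null F -> cotensor_map D = 0.
Proof.
have E0 E : coend_rel E -> (\pi_(coend G))%qT E = 0.
  move=> rE; rewrite -[0](raddf0 (\pi_(coend G))%qT); apply/eqP.
  by rewrite -Quotient.idealrBE subr0 inE; apply/asboolP.
rewrite inE => /asboolP; elim=> {D} [|D E _ D0 _ E0'|n phi psi t|n phi t u
  |n r phi psi t psiE|m n f phi t].
- by rewrite raddf0.
- by rewrite raddfB /= D0 E0' subrr.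
- by rewrite !raddfB /= !cotensor_map_sym -(E0 _ (CoendRelDl phi psi (a n t))) !raddfB.
- rewrite !raddfB /= !cotensor_map_sym linearD.
  by rewrite -(E0 _ (CoendRelDr phi (a n t) (a n u))) !raddfB.
- rewrite raddfB /= !cotensor_map_sym linearZ.
  by rewrite -(E0 _ (CoendRelZ (a n t) psiE)) raddfB.
- rewrite raddfB /= !cotensor_map_sym nt_natural.
  by rewrite -(E0 _ (CoendRelF f phi (a m t))) raddfB.
Qed.

Definition coend_map : coend F -> coend G := quot_lift cotensor_map.
Fact coend_map_additive : additive coend_map.
Proof. exact: quot_lift_additive cotensor_map_null. Qed.
HB.instance Definition _ :=
  GRing.isAdditive.Build (coend F) (coend G) coend_map coend_map_additive.

End CoendMap.

Definition Tor_with (T : functor R) (P : resolution T) (i : nat) : zmodType :=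
  if i is j.+1
  then homology (coend_map (res_diff P j.+1)) (coend_map (res_diff P j))
  else homology (coend_map (res_diff P 0%N))
                (\0 : {additive coend (P 0%N) -> coend (P 0%N)}).

Definition Tor (T : functor R) (i : nat) : zmodType :=
  Tor_with (std_resolution T) i.

End Coend.

Program Definition inclusion_functor (R : nzRingType) : functor R :=
  @Functor R (fun n => 'rV[R]_n) (fun m n f x => f x) _ _ _.
Next Obligation. by move=> R m n f; apply: linearP. Qed.
Next Obligation. by move=> R n x; rewrite /= id_lfunE. Qed.
Next Obligation. by move=> R l m n g f x; rewrite /= comp_lfunE. Qed.

Definition HML_homology (R : nzRingType) (T : functor R) (i : nat) : zmodType :=
  Tor T i.
Definition HML_cohomology (R : nzRingType) (T : functor R) (i : nat) : zmodType :=
  Ext (inclusion_functor R) T i.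

Section TensorPower.
Variables (A : comNzRingType) (d : nat).

Section TensorOb.
Variable M : vectType A.

Definition bvec (i : 'I_(dim M)) : M := r2v (delta_mx 0 i).

(* M^{(x) d} in coordinates: t i is the coefficient of t on the tensor        *)
(* bvec (i 0) (x) ... (x) bvec (i (d - 1)).                                   *)
Definition tensor := {ffun {ffun 'I_d -> 'I_(dim M)} -> A^o}.
HB.instance Definition _ := GRing.Lmodule.on tensor.

Definition pure (v : 'I_d -> M) : tensor :=
  [ffun i : {ffun 'I_d -> 'I_(dim M)} => \prod_k v2r (v k) 0 (i k)].

Definition sym_tensor : {pred tensor} :=
  [pred t : tensor | [forall s : 'S_d,
    [forall i : {ffun 'I_d -> 'I_(dim M)}, t [ffun k => i (s k)] == t i]]].

Lemma sym_tensorP (t : tensor) : reflect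
  (forall (s : 'S_d) (i : {ffun 'I_d -> 'I_(dim M)}), t [ffun k => i (s k)] = t i)
  (t \in sym_tensor).
Proof.
apply: (iffP forallP) => [H s i|H s]; first exact/eqP/(forallP (H s)).
by apply/forallP => i; apply/eqP.
Qed.

Fact sym_tensor_submod_closed : submod_closed sym_tensor.
Proof.
split=> [|a x y /sym_tensorP sx /sym_tensorP sy]; apply/sym_tensorP => s i.
  by rewrite !ffunE.
by rewrite !ffunE sx sy.
Qed.
HB.instance Definition _ :=
  GRing.isSubmodClosed.Build A tensor sym_tensor sym_tensor_submod_closed.

Record gamma := Gamma { gamma_val :> tensor; _ : gamma_val \in sym_tensor }.
HB.instance Definition _ := [isSub for gamma_val].
HB.instance Definition _ := [Choice of gamma by <:].
HB.instance Definition _ := [SubChoice_isSubLmodule of gamma by <:].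

Fact gpow_subproof (v : M) : pure (fun=> v) \in sym_tensor.
Proof.
apply/sym_tensorP => s i; rewrite !ffunE [RHS](reindex_inj (@perm_inj _ s)).
by apply: eq_bigr => k _; rewrite ffunE.
Qed.
Definition gpow (v : M) : gamma := Gamma (gpow_subproof v).

Lemma bvec_sum (v : M) : v = \sum_i v2r v 0 i *: bvec i.
Proof.
apply: (can_inj v2rK); rewrite linear_sum [LHS]row_sum_delta.
by apply: eq_bigr => i _; rewrite linearZ /= r2vK.
Qed.

End TensorOb.

Section TensorComp.
Variables X Y Z : vectType A.

Definition tcomp (s : tensor 'Hom(Y, Z)) (t : tensor 'Hom(X, Y)) :
    tensor 'Hom(X, Z) :=
  \sum_i \sum_j
    (s i * t j) *: pure (fun k => (bvec (i k) \o bvec (j k))%VF).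

Lemma tcompE s t l : tcomp s t l = \sum_i \sum_j
  (s i * t j) * \prod_k v2r (bvec (i k) \o bvec (j k))%VF 0 (l k).
Proof.
rewrite /tcomp sum_ffunE; apply: eq_bigr => i _.
by rewrite sum_ffunE; apply: eq_bigr => j _; rewrite !ffunE.
Qed.

Lemma tcomp_pure (g : 'I_d -> 'Hom(Y, Z)) (f : 'I_d -> 'Hom(X, Y)) :
  tcomp (pure g) (pure f) = pure (fun k => (g k \o f k)%VF).
Proof.
apply/ffunP => l; rewrite tcompE ffunE.
pose h k i j := v2r (bvec (M := 'Hom(Y, Z)) i \o bvec (M := 'Hom(X, Y)) j)%VF
  0 (l k).
have E k : v2r (g k \o f k)%VF 0 (l k)
    = \sum_i v2r (g k) 0 i * \sum_j v2r (f k) 0 j * h k i j.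
  have -> : (g k \o f k)%VF = \sum_i \sum_j
      (v2r (g k) 0 i * v2r (f k) 0 j) *: (bvec i \o bvec j)%VF.
    rewrite {1}[g k]bvec_sum {1}[f k]bvec_sum; apply/lfunP => x.
    rewrite comp_lfunE !sum_lfunE; apply: eq_bigr => i _.
    rewrite scale_lfunE linear_sum scaler_sumr sum_lfunE.
    apply: eq_bigr => j _.
    by rewrite !scale_lfunE comp_lfunE linearZ /= scalerA.
  rewrite linear_sum summxE; apply: eq_bigr => i _.
  rewrite linear_sum summxE mulr_sumr; apply: eq_bigr => j _.
  by rewrite linearZ /= mxE mulrA.
rewrite (eq_bigr _ (fun k _ => E k)) bigA_distr_bigA; apply: eq_bigr => i _.
rewrite big_split /= bigA_distr_bigA mulr_sumr; apply: eq_bigr => j _.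
by rewrite big_split /= !ffunE mulrA.
Qed.

Fact gcomp_subproof (s : gamma 'Hom(Y, Z)) (t : gamma 'Hom(X, Y)) :
  tcomp s t \in @sym_tensor 'Hom(X, Z).
Proof.
case: s t => [s /sym_tensorP sy_s] [t /sym_tensorP sy_t] /=.
apply/sym_tensorP => p l; rewrite !tcompE.
have reindexp (I : finType) (F : {ffun 'I_d -> I} -> A) :
    \sum_i F i = \sum_(i : {ffun 'I_d -> I}) F [ffun k => i (p k)].
  rewrite (reindex_inj (h := fun i : {ffun 'I_d -> I} => [ffun k => i (p k)])) //.
  move=> i j /ffunP ij; apply/ffunP => k.
  by have := ij ((p^-1)%g k); rewrite !ffunE permKV.
rewrite reindexp; apply: eq_bigr => i _; rewrite reindexp; apply: eq_bigr => j _.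
rewrite sy_s sy_t; congr (_ * _); rewrite [RHS](reindex_inj (@perm_inj _ p)).
by apply: eq_bigr => k _; rewrite !ffunE.
Qed.
Definition gcomp s t : gamma 'Hom(X, Z) := Gamma (gcomp_subproof s t).

End TensorComp.
End TensorPower.

(* A strict homogeneous polynomial functor of degree d over A: an A-linear    *)
(* functor to A-modules from the category with objects the A^n and morphisms  *)
(* Gamma^d(Hom_A(A^m, A^n)).                                                  *)
Record poly_functor (A : comNzRingType) (d : nat) := PolyFunctor {
  pob :> nat -> lmodType A;
  pmap : forall m n, gamma d (flin A m n) -> pob m -> pob n;
  pmap_linear : forall m n (g : gamma d (flin A m n)), linear (pmap g);
  pmap_linearl : forall m n (a : A) (g h : gamma d (flin A m n)) (x : pob m),
    pmap (a *: g + h) x = a *: pmap g x + pmap h x;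
  pmap1 : forall n (x : pob n), pmap (gpow d \1%VF) x = x;
  pmapM : forall l m n (g : gamma d (flin A m n)) (f : gamma d (flin A l m))
    (x : pob l), pmap (gcomp g f) x = pmap g (pmap f x) }.
Arguments pmap {A d} T {m n} g x : rename.

Lemma gpow_comp (A : comNzRingType) d (X Y Z : vectType A) (g : 'Hom(Y, Z))
  (f : 'Hom(X, Y)) : gpow d (g \o f)%VF = gcomp (gpow d g) (gpow d f).
Proof. by apply: val_inj; rewrite /= tcomp_pure. Qed.

Program Definition underlying_functor (A : comNzRingType) d
    (T : poly_functor A d) : functor A :=
  @Functor A T (fun m n f => pmap T (gpow d f)) _ _ _.
Next Obligation. by move=> A d T m n f; apply: pmap_linear. Qed.
Next Obligation. by move=> A d T n x; apply: pmap1. Qed.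
Next Obligation. by move=> A d T l m n g f x; rewrite /= gpow_comp pmapM. Qed.

(* Main.v *)
(* For a in A the maps F(a 1) : F(X) -> F(X) form an endomorphism of every     *)
(* functor F, natural in F because a is central.  On I it is multiplication    *)
(* by a, and on T multiplication by a ^+ d.  Lifting these scalars to a        *)
(* projective resolution in two ways, by F(a 1) and by the scalar itself,      *)
(* gives homotopic chain maps, so that a - a ^+ d annihilates Ext(I, T) and    *)
(* Tor(I^*, T).  As K has more than d elements, a in K can be chosen outside   *)
(* the roots of X^d - X, and then a - a ^+ d is invertible.                    *)
From mathcomp.multinomials Require Import freeg.
Require Import Defs.
From mathcomp Require Import all_boot all_order all_algebra.
From mathcomp Require Import boolp.

Import GRing.Theory VectorInternalTheory.
Local Open Scope ring_scope.
Local Obligation Tactic := idtac.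

(** The endomorphism [F(a 1) - k] ([defect]) commutes with all natural maps, so it is a chain map on
    every projective resolution; it is null homotopic as soon as [a] acts as [k] on the resolved
    functor ([null_homotopic]). For Ext, resolve [I] with [k = a]: on maps into [T] the defect is
    multiplication by [a ^+ d - a]. For Tor, resolve [T] with [k = a ^+ d]: in the coend [P(a 1)]
    moves onto the dual factor, so the defect acts as [a - a ^+ d] ([cotensZ]). A null-homotopic map
    that acts invertibly forces vanishing. *)

Section ProjectiveLifting.
Set Implicit Arguments.
Unset Strict Implicit.

(** By Yoneda it is enough to lift the images of the generators. Asking only that [q] reach the
    image of [a] lets one lift through differentials, which are onto the cycles but not onto their
    target. *)
Lemma free_functor_lift (R : nzRingType) (J : Type) (deg : J -> nat)
    (F G : functor R) (q : nattrans F G) (a : nattrans (free_functor R deg) G) :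
  (forall n x, exists y, q n y = a n x) -> exists b, nt_comp q b = a.
Proof.
move=> aq.
pose u j := cid (aq (deg j) << @free_genE R J deg _ j \1%VF >>).
exists (free_lift (fun j => sval (u j))); apply: nattransP => n.
apply: freeg_eqP => [||[j f]].
- by move=> c x y; rewrite !nt_linear.
- by move=> c x y; rewrite nt_linear.
rewrite -/(free_genE f) /= free_lift_funE nt_natural (svalP (u j)) -nt_natural /=.
by rewrite free_mapE comp_lfun1r.
Qed.

Program Definition nt_id (R : nzRingType) (F : functor R) : nattrans F F :=
  @NatTrans R F F (fun n x => x) _ _.
Next Obligation. by []. Qed.
Next Obligation. by []. Qed.

(* A projective functor is a retract of its free cover. *)
Lemma projective_lift (R : nzRingType) (P F G : functor R) (q : nattrans F G)
    (a : nattrans P G) :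
  projective P -> (forall n x, exists y, q n y = a n x) ->
  exists b, nt_comp q b = a.
Proof.
move=> projP aq; pose c := st_map (first_stage P).
have c_surj n y : exists x, c n x = y.
  exists << @free_genE _ _ _ _ (existT _ n y) \1%VF >>.
  by rewrite /= free_lift_funE fmap1.
have [s cs] := projP _ _ c (nt_id P) c_surj.
have [b qb] := free_functor_lift (a := nt_comp a c) (fun n x => aq n (c n x)).
exists (nt_comp b s); apply: nattransP => n x.
by rewrite -[RHS]/(a n (nt_id P n x)) -cs -[RHS]/(nt_comp a c n (s n x)) -qb.
Qed.

(** * Null homotopies on a projective resolution *)

Section Homotopy.
Variables (R : nzRingType) (T : functor R) (P : resolution T).
Variable f : forall i, nattrans (P i) (P i).
Hypothesis f_chain : forall i n x,
  f i n (res_diff P i n x) = res_diff P i n (f i.+1 n x).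
Hypothesis f_aug : forall n x, res_aug P n (f 0%N n x) = 0.

Lemma null_homotopic0 : exists h : nattrans (P 0%N) (P 1%N),
  forall n x, f 0%N n x = res_diff P 0%N n (h n x).
Proof.
have [n x|h hE] := projective_lift (q := res_diff P 0%N) (a := f 0%N) (@res_proj _ _ P 0%N).
  by apply/res_exact0.
by exists h => n x; rewrite -hE.
Qed.

(** The hypothesis says that [f - h d] takes values in cycles, hence lifts through the next
    differential. It constrains [h] only on boundaries, which serves both the start and the
    inductive step. *)
Lemma null_homotopic_step i (h : nattrans (P i) (P i.+1)) :
  (forall n x, res_diff P i n (h n (res_diff P i n x)) =
     f i n (res_diff P i n x)) ->
  exists h' : nattrans (P i.+1) (P i.+2), forall n x,
    f i.+1 n x = res_diff P i.+1 n (h' n x) + h n (res_diff P i n x).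
Proof.
move=> dhd.
have [n x|h' hE] := projective_lift (q := res_diff P i.+1)
  (a := f i.+1 - nt_comp h (res_diff P i)) (@res_proj _ _ P i.+1).
  by apply/res_exact; rewrite linearB /= dhd f_chain subrr.
exists h' => n x; rewrite -[res_diff _ _ _ _]/(nt_comp _ h' n x) hE /=.
by rewrite subrK.
Qed.

Lemma null_homotopic i : exists (h : nattrans (P i) (P i.+1))
    (h' : nattrans (P i.+1) (P i.+2)), forall n x,
  f i.+1 n x = res_diff P i.+1 n (h' n x) + h n (res_diff P i n x).
Proof.
elim: i => [|i [h [h' hE]]].
  have [h hE] := null_homotopic0; exists h.
  by apply: null_homotopic_step => n x; rewrite hE.
exists h'; apply: null_homotopic_step => n x.
rewrite hE; have -> : res_diff P i n (res_diff P i.+1 n x) = 0.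
  by apply/res_exact; exists x.
by rewrite linear0 addr0.
Qed.

End Homotopy.
End ProjectiveLifting.

(** * Homotheties and their action on Ext and Tor *)

Section Homothety.
Set Implicit Arguments.
Unset Strict Implicit.
Variable A : comNzRingType.

Program Definition nt_scale (F : functor A) (k : A) : nattrans F F :=
  @NatTrans A F F (fun n x => k *: x) _ _.
Next Obligation. by move=> F k n c x y; rewrite scalerDr !scalerA mulrC. Qed.
Next Obligation. by move=> F k m n f x; rewrite /= linearZ. Qed.

Program Definition homothety (F : functor A) (a : A) : nattrans F F :=
  @NatTrans A F F (fun n x => fmap F (a *: \1%VF) x) _ _.
Next Obligation. by move=> F a n c x y; rewrite linearP. Qed.
Next Obligation.
move=> F a m n f x; rewrite -!fmapM; congr (fmap _ _ _); apply/lfunP => v.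
by rewrite !comp_lfunE !scale_lfunE !id_lfunE linearZ.
Qed.

Definition defect (F : functor A) (a k : A) : nattrans F F :=
  homothety F a - nt_scale F k.

Lemma defectE (F : functor A) a k n (x : F n) :
  defect F a k n x = homothety F a n x - k *: x.
Proof. by []. Qed.

Lemma defect_natural (F G : functor A) (g : nattrans F G) a k n x :
  g n (defect F a k n x) = defect G a k n (g n x).
Proof. by rewrite linearB /= nt_natural linearZ. Qed.

Lemma homology_eq0 (U V W : zmodType) (f : {additive U -> V})
    (g : {additive V -> W}) :
  (forall v, g v = 0 -> exists u, f u = v) -> forall x : homology f g, x = 0.
Proof.
move=> gf x; rewrite -[x]reprK; set z := repr x.
rewrite -[0](raddf0 (\pi_(homology f g))%qT); apply/eqP.
rewrite -Quotient.idealrBE subr0 inE; apply/asboolP/gf/eqP.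
by case: z.
Qed.

Section Cohomology.
Variables (F G : functor A) (P : resolution F) (a k l b : A).
Hypothesis Fa : forall n (x : F n), homothety F a n x = k *: x.
Hypothesis Ga : forall n (x : G n), homothety G a n x = l *: x.
Hypothesis b_inv : b * (l - k) = 1.

(** Naturality gives [u = b (u o defect)]; with defect [d h' + h d] and [u d = 0], the cocycle [u]
    is the coboundary of [b u h]. *)
Lemma Ext_homothety_eq0 i (x : Ext_with G P i) : x = 0.
Proof.
have chain j n y := esym (defect_natural (res_diff P j) a k (n := n) y).
have aug n y : res_aug P n (defect (P 0%N) a k n y) = 0.
  by rewrite defect_natural defectE Fa subrr.
have rescale j (u : nattrans (P j) G) n y :
    u n y = b *: u n (defect (P j) a k n y).
  by rewrite defect_natural defectE Ga -scalerBl scalerA b_inv scale1r.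
have cocycle j (u : nattrans (P j) G) : precomp (res_diff P j) u = 0 ->
    forall n y, u n (res_diff P j n y) = 0.
  by move=> du n y; rewrite -[LHS]/(precomp (res_diff P j) u n y) du.
case: i x => [|i]; apply: homology_eq0 => u /cocycle du.
  (* The incoming differential is zero in degree 0, so [u] itself must vanish. *)
  exists 0; have [h hE] := null_homotopic0 (f := fun j => defect (P j) a k) aug.
  by apply: nattransP => n y; rewrite [RHS]rescale hE du scaler0.
have [h [h' hE]] := null_homotopic (f := fun j => defect (P j) a k) chain aug i.
exists (nt_comp (nt_scale G b) (nt_comp u h)); apply: nattransP => n y.
by rewrite [RHS]rescale hE linearD /= du add0r.
Qed.

End Cohomology.

Section Coend.
Local Open Scope quotient_scope.

Definition cotens (F : functor A) n (phi : 'Hom('rV[A]_n, A^o)) (t : F n) :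
  coend F := \pi_(coend F) (cosym phi t).

Lemma coend_rel_eq (F : functor A) D E :
  coend_rel (D - E) -> \pi_(coend F) D = \pi_(coend F) E.
Proof. by move=> r; apply/eqP; rewrite -Quotient.idealrBE inE; apply/asboolP. Qed.

Lemma cotensDr (F : functor A) n (phi : 'Hom('rV[A]_n, A^o)) (t u : F n) :
  cotens phi (t + u) = cotens phi t + cotens phi u.
Proof.
rewrite /cotens -raddfD; apply: coend_rel_eq.
by rewrite opprD addrA; apply: CoendRelDr.
Qed.

(** The coend relation turns [F(a 1)] into precomposition of [phi] with [a], which is [phi] times
    [a]; the tensor product over [A] then passes [a] to [t]. *)
Lemma cotensZ (F : functor A) n (phi : 'Hom('rV[A]_n, A^o)) (a : A) (t : F n) :
  cotens phi (homothety F a n t) = cotens phi (a *: t).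
Proof.
rewrite /cotens -(coend_rel_eq (CoendRelF _ phi t)); apply: coend_rel_eq.
apply: CoendRelZ => x.
by rewrite comp_lfunE scale_lfunE id_lfunE linearZ /= mulrC.
Qed.

Lemma coend_map_cotens (F G : functor A) (g : nattrans F G) n phi (t : F n) :
  coend_map g (cotens phi t) = cotens phi (g n t).
Proof.
rewrite /coend_map (quot_liftE (@cotensor_map_null _ _ _ g)).
exact: cotensor_map_sym.
Qed.

Lemma coend_ext (F : functor A) (W : zmodType) (f g : {additive coend F -> W}) :
  (forall n phi (t : F n), f (cotens phi t) = g (cotens phi t)) -> f =1 g.
Proof.
move=> fg x; rewrite -[x]reprK; elim/freeg_rect_dom0: (repr x) => [|k s D _ _ IH].
  by rewrite !raddf0.
rewrite !raddfD /= IH; congr (_ + _).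
have -> : << k *g s >> = << s >> *~ k :> {freeg (cotensor F) / int}.
  by rewrite freegU_mulz intz.
by rewrite !raddfMz; case: s => m [phi t]; congr (_ *~ _); apply: fg.
Qed.

Lemma coend_map_comp (F G H : functor A) (h : nattrans G H) (g : nattrans F G) x :
  coend_map (nt_comp h g) x = coend_map h (coend_map g x).
Proof.
apply: (coend_ext (g := coend_map h \o coend_map g)) x => n phi t.
by rewrite /= !coend_map_cotens.
Qed.

Lemma coend_map_add (F G : functor A) (g h : nattrans F G) x :
  coend_map (g + h) x = coend_map g x + coend_map h x.
Proof.
apply: (coend_ext (g := coend_map g \+ coend_map h)) x => n phi t.
by rewrite /= !coend_map_cotens cotensDr.
Qed.

(** The coend is only an abelian group here, so multiplication by [b] is expressed as the map
    induced by [nt_scale]. *)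
Lemma coend_map_defect (F : functor A) (a k b : A) x : b * (a - k) = 1 ->
  coend_map (nt_scale F b) (coend_map (defect F a k) x) = x.
Proof.
move=> b_inv; rewrite -coend_map_comp.
apply: (coend_ext (g := idfun)) x => n phi t.
apply: etrans (coend_map_cotens _ _ _) _.
rewrite -[LHS]/(cotens phi (b *: defect F a k n t)) -[RHS]/(cotens phi t) defectE.
rewrite scalerBr cotensDr -linearZ cotensZ -cotensDr scalerA mulrC -scalerA.
by rewrite -scalerBr -scalerBl scalerA b_inv scale1r.
Qed.

Variables (T : functor A) (P : resolution T) (a k b : A).
Hypothesis Ta : forall n (x : T n), homothety T a n x = k *: x.
Hypothesis b_inv : b * (a - k) = 1.

(** A cycle [z] equals [b (d h' + h d) z = d (b h' z)]. *)
Lemma Tor_homothety_eq0 i (x : Tor_with P i) : x = 0.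
Proof.
have chain j n y := esym (defect_natural (res_diff P j) a k (n := n) y).
have aug n y : res_aug P n (defect (P 0%N) a k n y) = 0.
  by rewrite defect_natural defectE Ta subrr.
have scale_diff j y : coend_map (nt_scale (P j) b) (coend_map (res_diff P j) y) =
    coend_map (res_diff P j) (coend_map (nt_scale (P j.+1) b) y).
  rewrite -!coend_map_comp; congr (coend_map _ y).
  by apply: nattransP => n z; rewrite /= linearZ.
case: i x => [|i]; apply: homology_eq0 => z dz; rewrite -(coend_map_defect z b_inv).
  have [h hE] := null_homotopic0 (f := fun j => defect (P j) a k) aug.
  exists (coend_map (nt_scale (P 1%N) b) (coend_map h z)).
  apply: etrans (esym (scale_diff _ _)) _.
  have -> : defect (P 0%N) a k = nt_comp (res_diff P 0%N) h.
    by apply: nattransP => n y; rewrite hE.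
  by rewrite coend_map_comp.
have [h [h' hE]] := null_homotopic (f := fun j => defect (P j) a k) chain aug i.
exists (coend_map (nt_scale (P i.+2) b) (coend_map h' z)).
apply: etrans (esym (scale_diff _ _)) _.
have -> : defect (P i.+1) a k =
    nt_comp (res_diff P i.+1) h' + nt_comp h (res_diff P i).
  by apply: nattransP => n y; rewrite hE.
by rewrite coend_map_add !coend_map_comp dz raddf0 addr0.
Qed.

End Coend.

Lemma gpowZ d (X : vectType A) (a : A) (v : X) :
  gpow d (a *: v) = a ^+ d *: gpow d v.
Proof.
apply/val_inj/ffunP => i; rewrite /= !ffunE.
under eq_bigr => j _ do rewrite /= linearZ /= mxE.
by rewrite big_split /= prodr_const card_ord.
Qed.

Lemma pmapZl d (T : poly_functor A d) m n (k : A) (g : gamma d (flin A m n))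
    (x : T m) : Defs.pmap T (k *: g) x = k *: Defs.pmap T g x.
Proof.
(* Writing [k = c + 1] puts the scalar multiple in the form [c *: g + g] covered by the linearity
   axiom. *)
rewrite -[k](subrK 1); move: (k - 1) => c.
by rewrite !scalerDl !scale1r pmap_linearl.
Qed.

Lemma homothety_underlying d (T : poly_functor A d) (a : A) n (x : T n) :
  homothety (underlying_functor T) a n x = a ^+ d *: x.
Proof. by rewrite /= gpowZ pmapZl; congr (_ *: _); apply: pmap1. Qed.

End Homothety.

(** As [d > 1], [X^d - X] has degree exactly [d], so it cannot vanish on more than [d] distinct
    elements of a field. *)
Lemma exists_expr_neq (K : fieldType) (d : nat) (s : seq K) :
  uniq s -> (1 < d < size s)%N -> exists a : K, a - a ^+ d != 0.
Proof.
move=> uniq_s /andP[d1 ds]; pose q : {poly K} := 'X^d - 'X.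
have size_q : size q = d.+1 by rewrite size_polyDl ?size_polyN ?size_polyX ?size_polyXn.
have q_neq0 : q != 0 by rewrite -size_poly_eq0 size_q.
have /allPn[a _] : ~~ all (root q) s.
  apply/negP => all_s; have := max_poly_roots q_neq0 all_s uniq_s.
  by rewrite size_q ltnS leqNgt ds.
rewrite /root !hornerE -oppr_eq0 opprB => ad.
by exists a.
Qed.

Theorem corollary10 (p d : nat) (K : fieldType) (A : comAlgType K)
    (T : poly_functor A d) :
  prime p -> p \in [pchar K] ->
  (exists s : seq K, uniq s /\ (d < size s)%N) -> (1 < d)%N ->
  forall i : nat,
    (forall x : HML_homology (underlying_functor T) i, x = 0) /\
    (forall x : HML_cohomology (underlying_functor T) i, x = 0).
Proof.
move=> _ _ [s [uniq_s ds]] d1 i.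
have [|a a_neq] := @exists_expr_neq K d s uniq_s; first by rewrite d1.
(* The inverse is taken in [K]: a nonzero element of [A] need not be a unit. *)
pose k : A := a%:A; pose b : A := ((a - a ^+ d)^-1)%:A.
have b_inv : b * (k - k ^+ d) = 1.
  by rewrite /b /k -!in_algE -rmorphXn -rmorphB -rmorphM mulVf // rmorph1.
have homT := @homothety_underlying A d T k.
split=> x; first exact: (@Tor_homothety_eq0 _ _ _ k (k ^+ d) b).
(* Now [I] is resolved instead of [T], so the two scalars swap and the inverse changes sign. *)
apply: (@Ext_homothety_eq0 _ _ _ _ k k (k ^+ d) (- b)) => //.
  by move=> n y /=; rewrite scale_lfunE id_lfunE.
by rewrite mulNr -mulrN opprB.
Qed.
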